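(* Assume Sarnak's Möbius Disjointness Conjecture: for every compact Hausdorff space $X$ and continuous $T:X\to X$ with zero topological entropy, every $x_0\in X$ and every $F\in C(X)$, $\lim_{N\to\infty}\frac1N\sum_{n=1}^N\mu(n)F(T^nx_0)=0$. Then every asymptotically periodic $f\in l^\infty(\mathbb{N})$ satisfies $\lim_{N\to\infty}\frac1N\sum_{n=1}^N\mu(n)f(n)=0$.
   Context: $\mu$ is the Möbius function; $(Af)(n)=f(n+1)$ on $l^\infty(\mathbb{N})$, $\mathbb{N}=\{0,1,\ldots\}$. A mean state is a functional $E_\omega(f)=\lim_{n\to\omega}\frac1n\sum_{j=0}^{n-1}f(j)$ with $\omega$ a free ultrafilter on $\mathbb{N}$; $\|f\|_E=E(|f|^2)^{1/2}$. A function $f\in l^\infty(\mathbb{N})$ is asymptotically periodic if for every mean state $E$ there is a sequence $(n_j)$ of positive integers with $\|f-A^{n_j}f\|_E\to0$. *)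

(* Defs.v *)
From HB Require Import structures.
From mathcomp Require Import all_boot all_order all_algebra.
From mathcomp Require Import all_classical all_reals all_analysis.
From mathcomp Require Export complex.
Set Implicit Arguments.
Unset Strict Implicit.
Unset Printing Implicit Defensive.
Import Order.TTheory GRing.Theory Num.Theory numFieldNormedType.Exports.
Local Open Scope classical_set_scope.
Local Open Scope ring_scope.
Local Open Scope complex_scope.

(* Only the values at n >= 1 are meaningful (mobius 0 is 1 by accident). *)
Definition mobius (n : nat) : int :=
  if all (fun p => logn p n == 1%N) (primes n)
  then (-1) ^+ size (primes n) else 0.

(* The regular module R[i]^o carries the usual topology of the complex plane. *)
Definition mobius_disjoint (R : realType) (f : nat -> R[i]^o) : Prop :=
  (N%:R^-1 * \sum_(1 <= n < N.+1) (mobius n)%:~R * f n : R[i]^o) @[N --> \oo]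
    --> (0 : R[i]^o).

Section TopologicalEntropy.
Variables (R : realType) (X : topologicalType).
Implicit Types (T : X -> X) (U : set (set X)).

Definition open_cover U : Prop :=
  (forall A, U A -> open A) /\ \bigcup_(A in U) A = [set: X].

(* N(U), attained as the infimum of a set of natural numbers, which is nonempty
   for an open cover of a compact space. *)
Definition cover_number U : R :=
  inf [set k%:R | k in [set k : nat | exists V : set (set X),
    [/\ V `<=` U, \bigcup_(A in V) A = [set: X] & (V #= `I_k)%card]]].

(* The join of U, T^-1 U, ..., T^-(n-1) U. *)
Definition cover_join T U (n : nat) : set (set X) :=
  [set \bigcap_(i in `I_n) (iter i T @^-1` s i)
    | s in [set s : nat -> set X | forall i, U (s i)]].

(* For X compact, T continuous and U an open cover, this limit exists in R by
   subadditivity. *)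
Definition cover_entropy T U : R :=
  limn (fun n : nat => n%:R^-1 * ln (cover_number (cover_join T U n)) : R).

Definition topological_entropy T : \bar R :=
  ereal_sup [set (cover_entropy T U)%:E | U in open_cover].

End TopologicalEntropy.

Definition sarnak_conjecture (R : realType) : Prop :=
  forall (X : topologicalType) (T : X -> X),
    compact [set: X] -> hausdorff_space X -> continuous T ->
    topological_entropy R T = 0%E ->
  forall (x0 : X) (F : X -> R[i]^o), continuous F ->
    mobius_disjoint (fun n => F (iter n T x0)).

Definition shift (V : Type) (f : nat -> V) : nat -> V := fun n => f n.+1.

Definition free_filter (T : Type) (w : set_system T) : Prop :=
  \bigcap_(A in w) A = set0.

(* On bounded f the limit exists, as w is an ultrafilter. *)
Definition ultramean (R : realType) (w : set_system nat) (f : nat -> R[i]^o)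
    : R[i]^o :=
  lim ((n%:R^-1 * \sum_(0 <= j < n) f j : R[i]^o) @[n --> w]).

Definition mean_state (R : realType) (E : (nat -> R[i]^o) -> R[i]^o) : Prop :=
  exists w : set_system nat,
    [/\ UltraFilter w, free_filter w & E = ultramean w].

Definition mean_norm (R : realType) (E : (nat -> R[i]^o) -> R[i]^o)
    (f : nat -> R[i]^o) : R[i]^o :=
  sqrtC (E (fun n => `|f n| ^+ 2)).

Definition asymptotically_periodic (R : realType) (f : nat -> R[i]^o) : Prop :=
  forall E : (nat -> R[i]^o) -> R[i]^o, mean_state E ->
  exists2 n_ : nat -> nat, (forall j, (0 < n_ j)%N) &
    mean_norm E (fun n => f n - iter (n_ j) (@shift _) f n) @[j --> \oo]
      --> (0 : R[i]^o).

(* Main.v *)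
Require Import Defs.
From mathcomp Require Import all_boot all_order all_algebra.
From mathcomp Require Import all_classical all_reals all_analysis.
From mathcomp Require Import zify ring lra.
Set Implicit Arguments.
Unset Strict Implicit.
Unset Printing Implicit Defensive.
Import Order.TTheory GRing.Theory Num.Theory numFieldNormedType.Exports.
Local Open Scope classical_set_scope.
Local Open Scope ring_scope.
Local Open Scope complex_scope.

(* Suppose |(1/N) sum_(n <= N) mu(n) f(n)| >= delta for all N in an infinite
   set S, and let w be a free ultrafilter containing S.  Asymptotic periodicity
   along w gives, for every e > 0, a shift n with
   sum_(m < N) |f(m + n) - f(m)| <= e N for w-many N; n can be made a multiple
   of any given integer, at the price of a smaller e.  Choose such scales
   n_0, n_1, ... with (i + 2) n_i | n_(i+1).  In the mixed radix expansion with
   digits of weight n_i and base i + 2, erasing the digit of weight n_i moves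
   f(m) little on average, and so does erasing all these digits, provided the
   errors e_i beat the multiplicity 2 * 3 * ... of the previous erasures.  The
   next scale may also be taken larger than some N in S that is good for all
   scales chosen so far, so the sequence g obtained from f by erasing all digits
   is close to f on average on [0, N) for arbitrarily large N in S.  On each
   aligned block of length (i + 2) n_i the sequence g is n_i-periodic, so, after
   rounding its values to a finite net, its orbit closure is a subshift of zero
   entropy.  By hypothesis mu is then disjoint from g: a contradiction. *)

(** * Erasing digits *)

(* Erases the base-[k] digit of weight [n] of [m]. *)
Definition erase (n k m : nat) : nat := (m %/ (k * n) * (k * n) + m %% n)%N.

Lemma eraseE (n k m : nat) : (0 < n)%N -> (0 < k)%N ->
  exists2 c, (c < k)%N & m = (erase n k m + c * n)%N.
Proof.
move=> n0 k0; exists (m %% (k * n) %/ n)%N.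
  by rewrite ltn_divLR// ltn_mod muln_gt0 k0.
rewrite {1}(divn_eq m (k * n)) /erase -addnA; congr addn.
by rewrite {1}(divn_eq (m %% (k * n)) n) addnC modn_dvdm// dvdn_mull.
Qed.

Lemma erase_le (n k m : nat) : (0 < n)%N -> (0 < k)%N -> (erase n k m <= m)%N.
Proof. by move=> n0 k0; have [c _ {2}->] := eraseE m n0 k0; exact: leq_addr. Qed.

Lemma erase_small (n k m : nat) : (0 < k)%N -> (m < n)%N -> erase n k m = m.
Proof.
by move=> k0 mn; rewrite /erase divn_small ?modn_small// (leq_trans mn) ?leq_pmull.
Qed.

Lemma ltn_mod_mull (n k x : nat) : (0 < n)%N -> (0 < k)%N -> (x %% n < k * n)%N.
Proof. by move=> n0 k0; rewrite (leq_trans (ltn_pmod _ n0))// leq_pmull. Qed.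

Lemma erase_div (n k m : nat) : (0 < n)%N -> (0 < k)%N ->
  (erase n k m %/ (k * n) = m %/ (k * n))%N.
Proof.
move=> n0 k0; rewrite /erase divnMDl ?muln_gt0 ?n0 ?k0//.
by rewrite (divn_small (ltn_mod_mull _ n0 k0)) addn0.
Qed.

Lemma erase_idem (n k m : nat) : (0 < n)%N -> (0 < k)%N ->
  erase n k (erase n k m) = erase n k m.
Proof.
move=> n0 k0; rewrite {1}/erase erase_div//.
by rewrite /erase mulnA modnMDl modn_mod.
Qed.

(** As [k * n] divides [n'], the two digits occupy disjoint places of one mixed radix expansion:
    erasing the lower one keeps the quotient by [k' * n'] ([E1]) and acts within the residue modulo
    [n'] ([E2]). *)
Lemma erase_comm (n k n' k' m : nat) : (0 < n)%N -> (0 < k)%N ->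
    (0 < n')%N -> (0 < k')%N -> (k * n %| n')%N ->
  erase n' k' (erase n k m) = erase n k (erase n' k' m).
Proof.
move=> n0 k0 n'0 k'0 dv.
have kn0 : (0 < k * n)%N by rewrite muln_gt0 k0.
have dv' : (k * n %| k' * n')%N by exact: dvdn_mull.
have dvn : (n %| n')%N by apply: dvdn_trans dv; exact: dvdn_mull.
have [c def_n'] := dvdnP dv.
have E1 : (erase n k m %/ (k' * n') = m %/ (k' * n'))%N.
  by rewrite def_n' mulnA (mulnC _ (k * n)%N) !(divnMA _ (k * n)) erase_div.
have E2 : (erase n k m %% n' = m %% n' %/ (k * n) * (k * n) + m %% n)%N.
  rewrite {1}/erase {1}(divn_eq m n').
  have -> : ((m %/ n' * n' + m %% n') %/ (k * n) =
             m %/ n' * (n' %/ (k * n)) + m %% n' %/ (k * n))%N.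
    by rewrite -divnMDl// -mulnA (divnK dv).
  rewrite mulnDl -mulnA (divnK dv)// -addnA modnMDl modn_small//.
  rewrite {2}def_n'; apply: (@leq_trans ((m %% n' %/ (k * n)).+1 * (k * n))%N).
    by rewrite mulSn addnC ltn_add2r ltn_mod_mull.
  by rewrite leq_mul2r ltn_divLR// -def_n' ltn_mod n'0 orbT.
rewrite {1}/erase E1 E2 /erase.
have -> : ((m %/ (k' * n') * (k' * n') + m %% n') %/ (k * n) =
   m %/ (k' * n') * (k' * n' %/ (k * n)) + m %% n' %/ (k * n))%N.
  by rewrite -divnMDl// -mulnA (divnK dv').
rewrite mulnDl -mulnA (divnK dv')// -!addnA; congr (_ + (_ + _))%N.
have /eqP dv0 : (n %| m %/ (k' * n') * (k' * n'))%N.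
  by rewrite !dvdn_mull.
by rewrite -modnDml dv0 add0n modn_dvdm.
Qed.

Section Sums.
Variable R : realType.

Lemma sum_subn (G : nat -> R) a N :
  \sum_(0 <= m < N) (if (a <= m)%N then G (m - a)%N else 0) =
  \sum_(0 <= m < N - a) G m.
Proof.
elim: N => [|N IH]; first by rewrite sub0n !big_geq.
rewrite big_nat_recr//= IH; case: leqP => aN.
  by rewrite subSn// [RHS]big_nat_recr.
by rewrite addr0 (eqP (ltnW aN)) (eqP aN).
Qed.

(** The digit of [m] varies with [m], so all [k] candidates are summed over: for the right [c],
    [erase n k m] is [m - c * n], and the other terms only add nonnegative amounts. *)
Lemma sum_erase (H : nat -> nat -> R) n k N : (0 < n)%N -> (0 < k)%N ->
    (forall x y, 0 <= H x y) ->
  \sum_(0 <= m < N) H m (erase n k m) <=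
  \sum_(0 <= c < k) \sum_(0 <= m < N) H (m + c * n)%N m.
Proof.
move=> n0 k0 H0.
apply: (@le_trans _ _ (\sum_(0 <= m < N) \sum_(0 <= c < k)
    (if (c * n <= m)%N then H (m - c * n + c * n)%N (m - c * n)%N else 0))).
  apply: ler_sum_nat => m _; have [c ck em] := eraseE m n0 k0.
  rewrite (bigD1_seq c) ?iota_uniq ?mem_index_iota//=.
  have cm : (c * n <= m)%N by rewrite em leq_addl.
  rewrite cm subnK//.
  have -> : (m - c * n)%N = erase n k m by rewrite {1}em addnK.
  by rewrite lerDl sumr_ge0// => i _; case: ifP.
rewrite exchange_big/=; apply: ler_sum_nat => c _.
rewrite (sum_subn (fun x => H (x + c * n)%N x)).
rewrite [leRHS](@big_cat_nat _ _ _ (N - c * n)%N)//= ?leq_subr//.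
by rewrite lerDl sumr_ge0.
Qed.

End Sums.

Section Erasures.
Variable n : nat -> nat.
Hypothesis n_gt0 : forall i, (0 < n i)%N.
Hypothesis n_dvd : forall i, (i.+2 * n i %| n i.+1)%N.

Fixpoint erasures (j m : nat) : nat :=
  if j is j'.+1 then erase (n j') j'.+2 (erasures j' m) else m.

(* Since [m < n m], the digits of weights [n j] with [j >= m] already vanish. *)
Definition erase_all (m : nat) : nat := erasures m m.

Lemma scale_dvd i j : (i < j)%N -> (i.+2 * n i %| n j)%N.
Proof.
elim: j => // j IH; rewrite ltnS leq_eqVlt => /predU1P[->//|/IH ij].
apply: dvdn_trans ij _; apply: dvdn_trans (n_dvd j); exact: dvdn_mull.
Qed.

Lemma scale_le i j : (i <= j)%N -> (n i <= n j)%N.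
Proof.
rewrite leq_eqVlt => /predU1P[->//|/scale_dvd/dvdn_leq-/(_ (n_gt0 _))].
by apply: leq_trans; rewrite leq_pmull.
Qed.

Lemma scale_gt i : (i < n i)%N.
Proof.
elim: i => // i IH; have := dvdn_leq (n_gt0 i.+1) (n_dvd i).
by apply: leq_trans; rewrite leq_pmulr.
Qed.

Lemma erasures_le j m : (erasures j m <= m)%N.
Proof. by elim: j => //= j; apply: leq_trans; rewrite erase_le. Qed.

Lemma erasures_stable i j m : (m < n i)%N -> (i <= j)%N ->
  erasures j m = erasures i m.
Proof.
move=> mi /subnK <-; elim: (j - i)%N => //= d IH.
rewrite IH erase_small// (leq_ltn_trans (erasures_le _ _))//.
by rewrite (leq_trans mi)// scale_le// leq_addl.
Qed.

Lemma erase_allE j m : (m < n j)%N -> erase_all m = erasures j m.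
Proof.
move=> mj; rewrite /erase_all; case: (leqP m j) => h.
  by rewrite (erasures_stable (scale_gt m) h).
by rewrite (erasures_stable mj (ltnW h)).
Qed.

Lemma erasures_erase i j m : (j <= i)%N ->
  erasures j (erase (n i) i.+2 m) = erase (n i) i.+2 (erasures j m).
Proof.
elim: j => //= j IH ji; rewrite IH ?(ltnW ji)//.
by rewrite [RHS]erase_comm// scale_dvd.
Qed.

(** The extra erasure commutes past those of lower weight until it meets the one of the same weight,
    where idempotence absorbs it. *)
Lemma erase_all_erase i m : erase_all (erase (n i) i.+2 m) = erase_all m.
Proof.
have e_le : (erase (n i) i.+2 m <= m)%N by rewrite erase_le.
pose j := maxn i.+1 m.
have mj : (m < n j)%N by rewrite (leq_trans (scale_gt m))// scale_le// leq_maxr.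
rewrite !(@erase_allE j)//; last exact: leq_ltn_trans mj.
have : (i < j)%N by rewrite leq_max leqnn.
elim: j {mj} => // j IH; rewrite ltnS leq_eqVlt => /predU1P[<-|/IH /= ->//].
by rewrite /= erasures_erase// erase_idem.
Qed.

Lemma erase_all_block i a r : (r < i.+2 * n i)%N ->
  erase_all (a * (i.+2 * n i) + r)%N = erase_all (a * (i.+2 * n i) + r %% n i)%N.
Proof.
move=> ri; rewrite -(@erase_all_erase i); congr erase_all.
rewrite /erase divnMDl ?muln_gt0 ?n_gt0// (divn_small ri) addn0; congr addn.
by rewrite mulnA modnMDl.
Qed.

Variable R : realType.

(* A bound for the fibres of [erasures i]. *)
Definition multiplicity (i : nat) : nat := (\prod_(0 <= j < i) j.+2)%N.

Lemma sum_erasures (h : nat -> R) i N : (forall x, 0 <= h x) ->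
  \sum_(0 <= m < N) h (erasures i m) <=
  (multiplicity i)%:R * \sum_(0 <= m < N) h m.
Proof.
elim: i h => [|i IH] h h0; first by rewrite /multiplicity big_nil mul1r.
have := IH (h \o erase (n i) i.+2) (fun x => h0 _) => /le_trans; apply.
rewrite /multiplicity big_nat_recr//= natrM -mulrA ler_wpM2l//.
apply: le_trans (@sum_erase _ (fun _ => h) _ _ _ _ _ _) _ => //=.
by rewrite sumr_const_nat subn0 mulr_natl.
Qed.

Variable d : nat -> nat -> R.
Hypothesis d_ge0 : forall x y, 0 <= d x y.
Hypothesis d_refl : forall x, d x x = 0.
Hypothesis d_triangle : forall x y z, d x z <= d x y + d y z.

(** The triangle inequality telescopes along the successive erasures. The step of index [j] is
    evaluated at the points [erasures j m], whence the factor [multiplicity j]. *)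
Lemma sum_dist_erasures (e : nat -> R) i N :
  (forall j, (j < i)%N -> \sum_(0 <= c < j.+2) \sum_(0 <= m < N)
     d (m + c * n j)%N m <= e j * N%:R) ->
  \sum_(0 <= m < N) d m (erasures i m) <=
    (\sum_(0 <= j < i) (multiplicity j)%:R * e j) * N%:R.
Proof.
elim: i => [|i IH] H.
  rewrite [X in _ <= X * _]big_geq// mul0r big1// => m _; exact: d_refl.
rewrite big_nat_recr//= mulrDl.
apply: (@le_trans _ _ (\sum_(0 <= m < N) d m (erasures i m) +
  \sum_(0 <= m < N) d (erasures i m) (erase (n i) i.+2 (erasures i m)))).
  by rewrite -big_split/=; apply: ler_sum => m _; exact: d_triangle.
apply: lerD; first by apply: IH => j ji; apply: H; exact: ltnW.
apply: le_trans (@sum_erasures (fun x => d x (erase (n i) i.+2 x)) _ _ _) _ => //.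
rewrite -mulrA ler_wpM2l//; apply: le_trans (H i _) => //.
exact: sum_erase.
Qed.

End Erasures.

(** * Choice of the scales *)

Section Scales.
Variables (R : realType) (w : set_system nat) (d : nat -> nat -> R) (B : R).
Context {FF : Filter w}.
Hypothesis w_tail : forall N0, w [set N | (N0 <= N)%N].
Hypothesis d_ge0 : forall x y, 0 <= d x y.
Hypothesis d_refl : forall x, d x x = 0.
Hypothesis d_triangle : forall x y z, d x z <= d x y + d y z.
Hypothesis d_le : forall x y, d x y <= B.

Let shift_dist (n N : nat) : R := \sum_(0 <= m < N) d (m + n)%N m.

(** A shift by [u * n] is a chain of [u] shifts by [n]. Starting at [m + n] instead of [m] moves the
    window of summation by [n], and the [n] new terms cost at most [B] each. *)
Lemma shift_dist_muln n u N :
  shift_dist (u * n) N <= u%:R * (shift_dist n N + n%:R * B).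
Proof.
elim: u => [|u IH].
  rewrite mul0r /shift_dist big1// => m _.
  by rewrite mul0n addn0 d_refl.
apply: (@le_trans _ _ (\sum_(0 <= m < N) d (m + n + u * n)%N (m + n)%N +
   shift_dist n N)).
  rewrite -big_split/=; apply: ler_sum => m _.
  by rewrite mulSn addnA; exact: d_triangle.
have shifted : \sum_(0 <= m < N) d (m + n + u * n)%N (m + n)%N <=
    shift_dist (u * n) N + n%:R * B.
  apply: (@le_trans _ _ (\sum_(0 <= m < N + n) d (m + u * n)%N m)).
    rewrite [leRHS](@big_cat_nat _ _ _ n)//= ?leq_addl//.
    rewrite -[X in _ <= _ + \sum_(X <= _ < _) _]add0n big_addn addnK lerDr.
    by apply: sumr_ge0 => *; exact: d_ge0.
  rewrite (@big_cat_nat _ _ _ N)//= ?leq_addr// lerD2l.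
  apply: le_trans (_ : \sum_(N <= m < N + n) B <= _); first exact: ler_sum.
  by rewrite sumr_const_nat addnC addnK mulr_natl.
rewrite -[u.+1]addn1 natrD mulrDl mul1r.
by have := lerD shifted (lexx (shift_dist n N)); lra.
Qed.

Hypothesis w_period : forall e : R, 0 < e ->
  exists2 n, (0 < n)%N & w [set N | shift_dist n N <= e * N%:R].

Lemma exists_long_period (e : R) (K k : nat) : 0 < e -> (0 < K)%N ->
  exists n, [/\ (0 < n)%N, (K %| n)%N &
    w [set N | \sum_(0 <= c < k) \sum_(0 <= m < N) d (m + c * n)%N m
                 <= e * N%:R]].
Proof.
(* A shift by [c * K * n] with [c < k] takes at most [k * K] shifts by [n], and there are [k] values
   of [c]; the successor keeps [C] positive when [k = 0]. *)
move=> e0 K0; pose C : R := (k * (k * K)).+1%:R.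
have C0 : 0 < C by rewrite ltr0n.
have [|n n0 wn] := w_period (e := e / (2 * C)).
  by rewrite divr_gt0 // mulr_gt0.
exists (K * n)%N; split; rewrite ?muln_gt0 ?K0 ?dvdn_mulr//.
have B0 : 0 <= B by rewrite (le_trans (d_ge0 0 0)).
pose N0 := Num.truncn (C * n%:R * B * 2 / e).
apply: filterS (filterI wn (w_tail N0.+1)) => N /= [hN hN0].
have {}hN0 : C * (n%:R * B) <= e / 2 * N%:R.
  have : C * n%:R * B * 2 / e < N%:R.
    by apply: lt_le_trans (truncnS_gt _) _; rewrite ler_nat.
  by rewrite ltr_pdivrMr// => h; lra.
apply: (@le_trans _ _ (C * (shift_dist n N + n%:R * B))); last first.
  rewrite mulrDr; have : C * shift_dist n N <= e / 2 * N%:R.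
    apply: le_trans (ler_wpM2l (ltW C0) hN) _.
    by rewrite le_eqVlt; apply/orP; left; apply/eqP; field; rewrite gt_eqF.
  by lra.
have s0 : 0 <= shift_dist n N + n%:R * B.
  by rewrite addr_ge0// ?mulr_ge0// sumr_ge0.
apply: (@le_trans _ _ (\sum_(0 <= c < k) ((k * K)%:R *
   (shift_dist n N + n%:R * B)))).
  apply: ler_sum_nat => c /andP[_ ck]; rewrite mulnA.
  apply: le_trans (shift_dist_muln _ _ _) _; rewrite ler_wpM2r// ler_nat.
  by rewrite leq_mul2r ltnW// orbT.
rewrite sumr_const_nat subn0 -mulrnAl ler_wpM2r//.
by rewrite -mulr_natl -natrM ler_nat leqnSn.
Qed.

Variable S : set nat.
Hypothesis wS : w S.
Hypothesis w_neq0 : forall A, w A -> A !=set0.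

Lemma exists_scales (eta : R) : 0 < eta ->
  exists n : nat -> nat, [/\ forall i, (0 < n i)%N,
    forall i, (i.+2 * n i %| n i.+1)%N &
    forall N0, exists N, [/\ (N0 <= N)%N, S N &
      \sum_(0 <= m < N) d m (erase_all n m) <= eta * N%:R]].
Proof.
move=> eta0.
have mult_gt0 i : (0 : R) < (multiplicity i)%:R.
  rewrite ltr0n /multiplicity; elim: i => [|i IH]; first by rewrite big_nil.
  by rewrite big_nat_recr//= muln_gt0 IH.
(* The weights [multiplicity j * e j] sum up to at most [eta]. *)
pose e (j : nat) : R := eta / ((multiplicity j)%:R * 2 ^+ j.+1).
have e0 j : 0 < e j by rewrite divr_gt0// mulr_gt0 ?exprn_gt0.
pose A (j n : nat) : set nat := [set N | \sum_(0 <= c < j.+2)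
   \sum_(0 <= m < N) d (m + c * n)%N m <= e j * N%:R].
(* [p] holds an index, the last scale and a [w]-large set of [N] good for all scales so far; [q]
   holds the next chosen [N] and the next scale. The premise sits under the existential so that
   [choice] yields a total function. *)
have step (p : nat * (nat * set nat)) : exists q : nat * nat,
   (0 < p.2.1)%N /\ w p.2.2 ->
   [/\ S q.1 /\ p.2.2 q.1, (p.1 <= q.1)%N, (q.1 <= q.2)%N,
     (0 < q.2)%N /\ (p.1.+2 * p.2.1 %| q.2)%N & w (A p.1.+1 q.2)].
  have [[n0 wp]|nh] := pselect ((0 < p.2.1)%N /\ w p.2.2); last first.
    by exists (0%N, 0%N).
  have [N [[SN pN] /= iN]] := w_neq0 (filterI (filterI wS wp) (w_tail p.1)).
  (* The factor [N.+1] of the divisor forces the new scale past [N]. The new digit has index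
     [p.1.+1], hence base [p.1.+3]. *)
  have [n [n'0 Kn wn]] := @exists_long_period (e p.1.+1)
    (p.1.+2 * p.2.1 * N.+1)%N p.1.+3 (e0 _) ltac:(by rewrite !muln_gt0 n0).
  exists (N, n) => _; split => //=.
    have /(dvdn_leq n'0) : (N.+1 %| n)%N.
      by apply: dvdn_trans Kn; exact: dvdn_mull.
    exact: ltnW.
  by split=> //; apply: dvdn_trans Kn; exact: dvdn_mulr.
have [nxt nxtP] := choice step.
have [n00 [n00_gt0 _ wn00]] := @exists_long_period (e 0%N) 1%N 2%N (e0 _) isT.
pose st := fix st i : nat * set nat := if i is j.+1 then
   let q := nxt (j, st j) in (q.2, (st j).2 `&` A j.+1 q.2) else (n00, A 0%N n00).
have inv i : (0 < (st i).1)%N /\ w (st i).2.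
  elim: i => [//|i IH] /=; have [_ _ _ [? _] ?] := nxtP (i, st i) IH.
  by split=> //; apply: filterI => //; exact: IH.2.
pose n i := (st i).1.
have n_gt0 i : (0 < n i)%N by exact: (inv i).1.
have n_dvd i : (i.+2 * n i %| n i.+1)%N.
  by have [_ _ _ [_ ?] _] := nxtP (i, st i) (inv i).
have stA i j : (j <= i)%N -> (st i).2 `<=` A j (n j).
  elim: i => [|i IH]; first by rewrite leqn0 => /eqP ->.
  rewrite leq_eqVlt => /predU1P[->|/IH]; first by move=> N [].
  by move=> h N [/h].
exists n; split=> // i.
have [[SN stN] iN Nn _ _] := nxtP (i, st i) (inv i).
set N := (nxt (i, st i)).1 in SN stN iN Nn.
exists N; split => //.
(* As [N <= n i.+1], only the first [i.+1] erasures act on [m < N], and [N] is good for all of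
   them. *)
have -> : \sum_(0 <= m < N) d m (erase_all n m) =
          \sum_(0 <= m < N) d m (erasures n i.+1 m).
  apply: eq_big_nat => m /andP[_ mN]; congr d; apply: erase_allE => //.
  exact: leq_trans mN _.
apply: le_trans (@sum_dist_erasures n n_gt0 R d d_ge0 d_refl d_triangle e _ _ _) _.
  by move=> j ji; exact: (stA i j).
rewrite ler_wpM2r//.
have -> : \sum_(0 <= j < i.+1) (multiplicity j)%:R * e j =
   eta * (1 - 2^-1 ^+ i.+1).
  elim: i.+1 => [|j IH]; first by rewrite big_geq// expr0 subrr mulr0.
  rewrite big_nat_recr//= IH /e !exprS exprVn; field.
  by rewrite expf_neq0 ?gt_eqF.
by rewrite ler_piMr ?ltW// gerBl ?exprn_ge0 ?invr_ge0.
Qed.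

End Scales.

(** * Zero topological entropy *)

Section Entropy.
Variables (R : realType) (X : topologicalType) (T : X -> X) (a : X -> nat).

Definition same_name (n : nat) (x y : X) : Prop :=
  forall t, (t < n)%N -> a (iter t T x) = a (iter t T y).

(** Subexponential growth of the number of names of length [n]; the code [c] bounds this number
    without counting classes. *)
Definition low_complexity : Prop := forall e : R, 0 < e ->
  \forall n \near \oo, exists c : X -> nat, exists p : nat,
  [/\ forall x, (c x < p)%N, forall x y, c x = c y -> same_name n x y &
      ln p%:R <= e * n%:R].

Hypothesis X_compact : compact [set: X].
Variable x0 : X.
Hypothesis a_cont : forall t x, \forall y \near x, a (iter t T y) = a (iter t T x).
Hypothesis a_sep : forall x y : X,
  (forall t, a (iter t T x) = a (iter t T y)) -> x = y.

Lemma near_same_name n x : \forall y \near x, same_name n x y.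
Proof.
elim: n => [|n IH]; first exact: nearW.
apply: filterS (filterI IH (a_cont n x)) => y [h1 h2] t.
by rewrite ltnS leq_eqVlt => /predU1P[->//|]; exact: h1.
Qed.

(** A point [y] other than [x] gets a different symbol at some time, so no point near [y] shares a
    long name with [x]; near [x] itself [U] will do. Compactness makes the length uniform. *)
Lemma same_name_nbhs x (U : set X) : nbhs x U ->
  exists n, forall y, same_name n x y -> U y.
Proof.
move=> xU; have /compact_near_coveringP cov := X_compact.
have [|N _ h] := cov nat \oo (fun n y => same_name n x y -> U y) _.
  move=> y _; have [[t xyt]|xy] :=
      pselect (exists t, a (iter t T x) <> a (iter t T y)).
    exists ([set z | same_name t.+1 y z], [set n | (t < n)%N]).
      by split; [exact: near_same_name | exact: nbhs_infty_ge].
    move=> [z n] [/= yz tn] xz; exfalso; apply: xyt.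
    by rewrite (xz t tn) (yz t (ltnSn t)).
  have -> : y = x.
    by apply/esym/a_sep => t; apply: contrapT => xyt; apply: xy; exists t.
  exists (U, setT); first by split=> //; exact: filterT.
  by move=> [z n] [].
by exists N => y; apply: h => //=.
Qed.

(** Names of length [m] play the role of balls of a Lebesgue radius. *)
Lemma lebesgue_number (U : set (set X)) : open_cover U ->
  exists m, forall x, exists A, U A /\ forall y, same_name m x y -> A y.
Proof.
move=> [Uo Uc]; have /compact_near_coveringP cov := X_compact.
have [|N _ h] := cov nat \oo
   (fun n x => exists A, U A /\ forall y, same_name n x y -> A y) _.
  move=> x _; have [A UA Ax] : (\bigcup_(A in U) A) x by rewrite Uc.
  have [m mA] := same_name_nbhs (open_nbhs_nbhs (conj (Uo _ UA) Ax)).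
  exists ([set y | same_name m x y], [set n | (m <= n)%N]).
    by split; [exact: near_same_name | exact: nbhs_infty_ge].
  move=> [z n] [/= xz mn]; exists A; split=> // y zy; apply: mA => t tm.
  by rewrite xz// zy// (leq_trans tm).
by exists N => x; exact: (h N (leqnn N)).
Qed.

(** The point [x0] excludes an empty subcover; the resulting lower bound later makes the logarithm
    nonnegative. *)
Lemma cover_number_bounds (U : set (set X)) (p : nat) (V : nat -> set X) :
  (forall i, U (V i)) -> (forall x, exists2 i, (i < p)%N & V i x) ->
  1 <= cover_number R U <= p%:R.
Proof.
move=> UV Vcov; rewrite /cover_number; set E := [set k%:R | k in _].
have Elb : lbound E 1.
  move=> _ [k [W [_ Wc Wk]] <-]; rewrite ler1n lt0n; apply/eqP => k0.
  have : (\bigcup_(A in W) A) x0 by rewrite Wc.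
  have : W = set0.
    by apply/eqP; rewrite -(card_eq0 (U := nat)) -II0 -k0.
  by move=> -> [].
pose W := V @` `I_p.
have Wle : (W #<= `I_p)%card by exact: card_image_le.
have /finite_setP[k Wk] := card_le_finite Wle (finite_II p).
have kp : (k <= p)%N by rewrite -card_le_II -(card_le_eql Wk).
have Ek : E k%:R.
  exists k => //; exists W; split => //; first by move=> _ [i _ <-].
  apply/seteqP; split=> // x _; have [i ip Vx] := Vcov x.
  by exists (V i) => //; exists i.
apply/andP; split; first by apply: lb_le_inf => //; exists k%:R.
apply: (@le_trans _ _ k%:R); last by rewrite ler_nat.
by apply: ge_inf => //; exists 1.
Qed.

(** A name of length [n + m] fixes the name of length [m] of each of the first [n] iterates, hence a
    member of [U] around each. So [p] members of the join cover the space. *)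
Lemma cover_entropy_eq0 (U : set (set X)) : low_complexity -> open_cover U ->
  cover_entropy R T U = 0.
Proof.
move=> lowc /lebesgue_number[m /choice[A_ A_P]].
have A_U x : U (A_ x) by case: (A_P x).
have A_sub x y : same_name m x y -> A_ x y by case: (A_P x) => _ /(_ y).
apply: (@cvg_lim R^o) => //; apply/cvgr0Pnorm_le => e e0.
(* The half pays for replacing [n + m] by [n + n]. *)
have e20 : 0 < e / 2 by rewrite divr_gt0.
have [N _ hN] := lowc _ e20.
near=> n.
have n_gt0 : (0 < n)%N by near: n; exact: nbhs_infty_gt.
have [|c [p [cp c_name ln_p]]] := hN (n + m)%N.
  by rewrite /= (@leq_trans n) ?leq_addr//; near: n; exact: nbhs_infty_ge.
(* A representative of each code, with default [x0] for codes that are not taken. *)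
pose r i := xget x0 [set x | c x = i].
pose V i : set X := \bigcap_(j in `I_n) (iter j T @^-1` A_ (iter j T (r i))).
have := @cover_number_bounds (cover_join T U n) p V.
case/(_ _ _)/andP => [i|x|ge1 lep].
- by exists (fun j => A_ (iter j T (r i))) => // j; exact: A_U.
- exists (c x); first exact: cp.
  move=> j /= jn; apply: A_sub => t tm; rewrite -!iterD.
  apply: (c_name _ _ _ (t + j)%N); last by lia.
  exact: (@xgetPex _ x0 [set y | c y = c x] (ex_intro _ x erefl)).
have cn_gt0 := lt_le_trans ltr01 ge1.
have n0 : (0 : R) < n%:R by rewrite ltr0n.
rewrite ger0_norm ?mulr_ge0 ?invr_ge0 ?ln_ge0// mulrC ler_pdivrMr//.
apply: le_trans (_ : ln p%:R <= _).
  by rewrite ler_ln// ?posrE// (lt_le_trans cn_gt0).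
apply: le_trans ln_p _.
have -> : e * n%:R = e / 2 * (n + n)%:R.
  by rewrite natrD; field.
rewrite ler_pM2l// ler_nat leq_add2l.
by near: n; exact: nbhs_infty_ge.
Unshelve. all: by end_near. Qed.

Lemma topological_entropy_eq0 : low_complexity -> topological_entropy R T = 0%E.
Proof.
move=> lowc; rewrite /topological_entropy -[RHS]ereal_sup1; congr ereal_sup.
apply/seteqP; split=> [_ [U oU <-]|_ ->] /=.
  by rewrite cover_entropy_eq0.
(* The trivial cover keeps the supremum from being that of an empty family, which is minus
   infinity. *)
have oT : open_cover [set [set: X]].
  split; first by move=> _ ->; exact: openT.
  by apply/seteqP; split=> // x _; exists setT.
by exists [set setT] => //; rewrite cover_entropy_eq0.
Qed.

End Entropy.

(** * The subshift of a block-periodic sequence *)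

Definition sequences : topologicalType := prod_topology (fun _ : nat => nat).

(** The filter is pushed forward to [Y], where it clusters at a point of [A]; open sets of the
    subtype are traces of open sets of [Y], so it also clusters at the lifted point. *)
Lemma compact_set_type (Y : topologicalType) (A : set Y) :
  compact A -> compact [set: set_type A].
Proof.
move=> cA F PF _.
have PG : ProperFilter (set_val @ F) by exact: fmap_proper_filter.
have [|y [Ay yF]] := cA (set_val @ F) PG.
  change (F (set_val @^-1` A)).
  suff -> : set_val @^-1` A = [set: set_type A] by exact: filterT.
  by apply/seteqP; split=> [[z zA]|[z zA]] // _; exact: set_mem zA.
exists (exist _ y (mem_set Ay)); split=> // G U FG [_ [[V oV <-] /= Vy VU]].
have VG : F (set_val @^-1` (set_val @` G)).
  by apply: filterS FG => z Gz; exists z.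
have [_ [[z Gz <-] Vz]] := yF _ V VG (open_nbhs_nbhs (conj oV Vy)).
by exists z; split=> //; exact: VU.
Qed.

Section Subshift.
Variables (R : realType) (g : nat -> nat) (Q : nat).
Hypothesis g_le : forall m, (g m <= Q)%N.

(** The closure of the shift orbit of [g], described through finite words. *)
Definition subshift : set sequences :=
  [set x | forall n, exists s, forall t, (t < n)%N -> x t = g (s + t)%N].

Lemma near_coord (x : sequences) t : \forall y \near x, y t = x t.
Proof.
have h : nbhs (x t : nat) [set x t] by rewrite nbhs_principalE; apply/principal_filterP.
exact: (@proj_continuous nat (fun=> nat) t x _ h).
Qed.

Lemma near_prefix (x : sequences) n :
  \forall y \near x, forall t, (t < n)%N -> y t = x t.
Proof.
elim: n => [|n IH]; first by apply: (filterS (P := setT)) filterT.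
apply: filterS (filterI IH (near_coord x n)) => y [h1 h2] t.
by rewrite ltnS leq_eqVlt => /predU1P[->//|]; exact: h1.
Qed.

Lemma subshift_compact : compact subshift.
Proof.
apply: (@subclosed_compact _ subshift [set x : sequences | forall i, `I_Q.+1 (x i)]).
- move=> x clx n; have [y [gy xy]] := clx _ (near_prefix x n).
  have [s ys] := gy n; exists s => t tn.
  by rewrite -(ys t tn) (xy t tn).
- exact: (@tychonoff nat (fun=> nat) (fun=> `I_Q.+1)
    (fun=> finite_compact (finite_II _))).
- by move=> x gx i /=; have [s ->//] := gx i.+1; rewrite ltnS.
Qed.

Lemma subshift_closed_shift (x : sequences) :
  subshift x -> subshift ((fun n => x n.+1) : sequences).
Proof.
move=> gx n; have [s xs] := gx n.+1.
by exists s.+1 => t tn; rewrite xs ?ltnS// addSnnS.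
Qed.

Definition subshift_map (x : set_type subshift) : set_type subshift :=
  exist (fun x : sequences => x \in subshift) _
    (mem_set (subshift_closed_shift (set_mem (valP x)))).

Definition head_symbol (x : set_type subshift) : nat := (set_val x : sequences) 0%N.

Lemma head_iter t x : head_symbol (iter t subshift_map x) = (set_val x : sequences) t.
Proof. by elim: t x => [|t IH] x //; rewrite iterSr IH. Qed.

Lemma near_symbol (x : set_type subshift) t :
  \forall y \near x, (set_val y : sequences) t = (set_val x : sequences) t.
Proof. exact: (@initial_continuous _ _ set_val x _ (near_coord _ t)). Qed.

Lemma subshift_sep (x y : set_type subshift) :
  (forall t, (set_val x : sequences) t = (set_val y : sequences) t) -> x = y.
Proof. by move=> xy; apply/val_inj/funext. Qed.

Lemma subshift_hausdorff : hausdorff_space (set_type subshift).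
Proof.
move=> x y xy; apply: subshift_sep => t.
have [z [<- //]] := xy _ _ (near_symbol x t) (near_symbol y t).
Qed.

Lemma head_continuous : continuous head_symbol.
Proof.
move=> x U /=; rewrite nbhs_principalE => Ux.
by apply: filterS (near_symbol x 0) => y yx; rewrite /= /head_symbol yx; exact: Ux.
Qed.

Lemma initial_word : subshift (g : sequences).
Proof. by move=> n; exists 0%N. Qed.

Definition subshift_point : set_type subshift :=
  exist (fun x : sequences => x \in subshift) _ (mem_set initial_word).

Lemma subshift_symbol_cont t x :
  \forall y \near x, head_symbol (iter t subshift_map y) =
                    head_symbol (iter t subshift_map x).
Proof. by apply: filterS (near_symbol x t) => y; rewrite !head_iter. Qed.

Lemma subshift_symbol_sep x y :
  (forall t, head_symbol (iter t subshift_map x) =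
             head_symbol (iter t subshift_map y)) -> x = y.
Proof.
by move=> xy; apply: subshift_sep => t; have := xy t; rewrite !head_iter.
Qed.

Lemma subshift_map_continuous : continuous subshift_map.
Proof.
move=> x U /= xU.
have [n nU] := same_name_nbhs (compact_set_type subshift_compact)
  subshift_symbol_cont subshift_symbol_sep xU.
apply: filterS (near_same_name subshift_symbol_cont n.+1 x) => y xy.
by apply: nU => t tn; have := xy t.+1 tn; rewrite !iterSr.
Qed.

Hypothesis g_block : forall K0 : nat, exists p K, [/\ (K0 <= K)%N, (0 < p)%N &
  forall b r, (r < K * p)%N -> g (b * (K * p) + r)%N = g (b * (K * p) + r %% p)%N].

Lemma subshift_low_complexity : low_complexity R subshift_map head_symbol.
Proof.
move=> e e0.
pose lnQ : R := ln Q.+1%:R.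
have lnQ0 : 0 <= lnQ by rewrite ln_ge0// ler1n.
(* The exponential growth rate of the number of words will be at most [lnQ / K]; this [K] brings it
   below [e / 2]. *)
have [p [K [K0 p0 blk]]] := g_block (Num.truncn (2 * lnQ / e)).+1.
have K_gt0 : (0 < K)%N by exact: leq_trans K0.
set L := (K * p)%N in blk.
have L0 : (0 < L)%N by rewrite muln_gt0 K_gt0.
(* A word of length [n] at position [s] of [g] is determined by [s %% L] and by
   the first period of each of the aligned blocks of length [L] that it meets. *)
pose C n : finType := ('I_L * {ffun 'I_(n %/ L).+2 * 'I_p -> 'I_Q.+1})%type.
have pos n (x : set_type subshift) :
    {s | forall t, (t < n)%N -> (set_val x : sequences) t = g (s + t)%N}.
  by apply: cid; apply: (set_mem (valP x)).
pose s n x := projT1 (pos n x).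
have sP n x t : (t < n)%N -> (set_val x : sequences) t = g (s n x + t)%N.
  by rewrite /s; case: (pos n x) => s' /= /(_ t).
pose code n x : C n := (Ordinal (ltn_pmod (s n x) L0),
  [ffun bj : 'I_(n %/ L).+2 * 'I_p => inord (g ((s n x %/ L + bj.1) * L + bj.2)%N)]).
have codeP n x t (tn : (t < n)%N) :
    let r := ((code n x).1 + t)%N in
    (set_val x : sequences) t =
    (code n x).2 (inord (r %/ L), Ordinal (ltn_pmod (r %% L) p0)) :> nat.
  rewrite (sP _ _ _ tn) /= ffunE /=; set a := s n x.
  (* The offset [a %% L] is below [L] and [t < n], so the word meets at most [n %/ L + 2] aligned
     blocks. *)
  have h : ((a %% L + t) %/ L < (n %/ L).+2)%N.
    rewrite ltn_divLR// !mulSn {1}addnA; apply: (@leq_trans (L + n)%N).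
      by rewrite -addnS leq_add// ltnW// ltn_mod.
    rewrite -addnA leq_add2l {1}(divn_eq n L) addnC leq_add2r.
    by rewrite ltnW// ltn_mod.
  rewrite !inordK ?ltnS//.
  rewrite -blk ?ltn_mod// mulnDl -addnA -divn_eq; congr g.
  by rewrite addnA -divn_eq.
have card_C n : #|C n| = (L * Q.+1 ^ ((n %/ L).+2 * p))%N.
  by rewrite card_prod card_ffun card_prod !card_ord.
near=> n.
exists (fun x => nat_of_ord (enum_rank (code n x))), #|C n|; split.
- by move=> x; exact: ltn_ord.
- move=> x y /val_inj/enum_rank_inj xy t tn.
  by rewrite !head_iter (codeP n x t tn) (codeP n y t tn) xy.
rewrite card_C natrM lnM ?posrE ?ltr0n ?expn_gt0// natrX lnXn ?ltr0n// -/lnQ.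
rewrite -[lnQ *+ _]mulr_natl (natrM _ (n %/ L).+2).
have hn : (n %/ L).+2%:R <= n%:R / L%:R + 2 :> R.
  rewrite -addn2 natrD lerD2r ler_pdivlMr ?ltr0n// -natrM ler_nat.
  exact: leq_trunc_div.
have hK : 2 * lnQ <= e * K%:R.
  have : 2 * lnQ / e < K%:R.
    by apply: lt_le_trans (truncnS_gt _) _; rewrite ler_nat.
  by rewrite ltr_pdivrMr// => h; lra.
have hp : p%:R * lnQ / L%:R <= e / 2.
  rewrite ler_pdivrMr ?ltr0n// /L natrM.
  by have := ler_wpM2l (ler0n R p) hK; lra.
(* The rate [p * lnQ / L] is at most [e / 2]; the other half of [e] absorbs the terms constant in
   [n]. *)
apply: (@le_trans _ _ (ln L%:R + 2 * p%:R * lnQ + n%:R * (e / 2))).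
  rewrite -addrA lerD2l.
  apply: (@le_trans _ _ ((n%:R / L%:R + 2) * p%:R * lnQ)).
    by rewrite ler_wpM2r// ler_wpM2r.
  have := ler_wpM2l (ler0n R n) hp; lra.
suff : ln L%:R + 2 * p%:R * lnQ <= n%:R * (e / 2) by lra.
rewrite -ler_pdivrMr ?divr_gt0//; near: n; exact: nbhs_infty_ger.
Unshelve. all: by end_near. Qed.

(** [g] is read off as the head symbol along the orbit of [subshift_point], and any [F] on the
    discrete set of symbols is continuous. *)
Lemma sarnak_block_periodic (F : nat -> R[i]^o) :
  sarnak_conjecture R -> mobius_disjoint (fun n => F (g n)).
Proof.
move=> sarnak.
have -> : (fun n => F (g n)) =
    (fun n => F (head_symbol (iter n subshift_map subshift_point))).
  by apply/funext => n; rewrite head_iter.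
apply: (sarnak _ subshift_map _ _ _ _ subshift_point (F \o head_symbol)).
- exact: compact_set_type subshift_compact.
- exact: subshift_hausdorff.
- exact: subshift_map_continuous.
- apply: (topological_entropy_eq0 (compact_set_type subshift_compact)
    subshift_point subshift_symbol_cont subshift_symbol_sep).
  exact: subshift_low_complexity.
- move=> x; apply: continuous_comp; first exact: head_continuous.
  move=> U /= UF; have UFx : U (F (head_symbol x)) := nbhs_singleton UF.
  have h : nbhs (head_symbol x : nat) (F @^-1` U).
    by rewrite nbhs_principalE; apply/principal_filterP.
  exact: h.
Qed.

End Subshift.

(** * Complex numbers and ultrafilter limits *)

Section RealNorm.
Variable R : realType.
Implicit Types z : R[i].

(** The modulus as an element of [R], since the norm of [R[i]] takes its values in [R[i]]. *)
Definition cabs z : R := complex.Re `|z|.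

Lemma normE z : `|z| = (cabs z)%:C.
Proof. by rewrite /cabs RRe_real// normr_real. Qed.

Lemma cabs_ge0 z : 0 <= cabs z.
Proof. by rewrite -ler0c -normE. Qed.

Lemma cabs0 : cabs 0 = 0.
Proof. by rewrite /cabs normr0. Qed.

Lemma cabsD z1 z2 : cabs (z1 + z2) <= cabs z1 + cabs z2.
Proof. by rewrite -lecR rmorphD -!normE ler_normD. Qed.

Lemma cabsM z1 z2 : cabs (z1 * z2) = cabs z1 * cabs z2.
Proof. by apply: complexI; rewrite rmorphM -!normE normrM. Qed.

Lemma cabsC z1 z2 : cabs (z1 - z2) = cabs (z2 - z1).
Proof. by rewrite /cabs distrC. Qed.

Lemma cabsR (r : R) : cabs r%:C = `|r|.
Proof. by apply: complexI; rewrite -normE normc_def/= expr0n addr0 sqrtr_sqr. Qed.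

Lemma cabs_natV n : cabs (n%:R^-1) = n%:R^-1.
Proof. by apply: complexI; rewrite -normE fmorphV rmorph_nat normfV normr_nat. Qed.

Lemma cabs_sum (h : nat -> R[i]) m n :
  cabs (\sum_(m <= i < n) h i) <= \sum_(m <= i < n) cabs (h i).
Proof.
rewrite -lecR -normE rmorph_sum/=; apply: le_trans (ler_norm_sum _ _ _) _.
by apply: ler_sum => i _; rewrite normE.
Qed.

Lemma cabs_Complex (a b : R) : cabs (a +i* b) <= `|a| + `|b|.
Proof.
have -> : a +i* b = a%:C + 'i * b%:C by rewrite [LHS]complexE.
apply: le_trans (cabsD _ _) _; rewrite cabsM !cabsR.
suff -> : cabs 'i = 1 by rewrite mul1r.
by apply: complexI; rewrite -normE normc_def/= expr0n expr1n add0r sqrtr1.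
Qed.

Lemma Re_le_cabs z : `|complex.Re z| <= cabs z.
Proof. by rewrite -lecR -normE normc_ge_Re. Qed.

Lemma Im_le_cabs z : `|complex.Im z| <= cabs z.
Proof.
have -> : complex.Im z = complex.Re (- 'i * z).
  by case: z => a b /=; lra.
apply: le_trans (Re_le_cabs _) _; rewrite cabsM.
suff -> : cabs (- 'i) = 1 by rewrite mul1r.
by apply: complexI; rewrite -normE normc_def/= oppr0 expr0n sqrrN expr1n add0r sqrtr1.
Qed.

Lemma cabs_mobius n : cabs (mobius n)%:~R <= 1.
Proof.
rewrite -lecR -normE /mobius; case: ifP => _; last by rewrite normr0 ler01.
by rewrite rmorphXn/= normrX normrN1 expr1n.
Qed.

(** A square grid of mesh [eta / 2]; the grid point with coordinates [i], [j] has index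
    [i * K + j]. *)
Lemma finite_net (B eta : R) : 0 < eta -> exists Q (dec : nat -> R[i]),
  forall z, cabs z <= B -> exists2 i, (i <= Q)%N & cabs (z - dec i) <= eta.
Proof.
move=> eta0; pose h := eta / 2; have h0 : 0 < h by rewrite divr_gt0.
pose K := (Num.truncn (2 * B / h)).+1.
pose x i : R := i%:R * h - B.
have net (a : R) : `|a| <= B -> exists2 i, (i < K)%N & `|a - x i| <= h.
  move=> aB; have [aB1 aB2] : 0 <= a + B /\ a + B <= 2 * B.
    by move: aB; rewrite ler_norml => /andP[]; split; lra.
  exists (Num.truncn ((a + B) / h)).
    by rewrite ltnS le_truncn// ler_pM2r ?invr_gt0.
  have /truncn_itv/andP[] : 0 <= (a + B) / h by rewrite divr_ge0// ltW.
  rewrite ler_pdivlMr// ltr_pdivrMr// -addn1 natrD => l1 l2.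
  by rewrite /x ler_norml; apply/andP; split; lra.
exists (K * K)%N, (fun c => x (c %/ K)%N +i* x (c %% K)%N) => z zB.
have [i iK ih] := net (complex.Re z) (le_trans (Re_le_cabs z) zB).
have [j jK jh] := net (complex.Im z) (le_trans (Im_le_cabs z) zB).
exists (i * K + j)%N; first by nia.
rewrite divnMDl// divn_small// addn0 modnMDl modn_small//.
have -> : z - (x i +i* x j) = (complex.Re z - x i) +i* (complex.Im z - x j).
  by case: z {zB ih jh}.
apply: le_trans (cabs_Complex _ _) _.
by rewrite (_ : eta = h + h) ?lerD// /h; lra.
Qed.

Lemma bounded_cabs (f : nat -> R[i]^o) : bounded_fun f ->
  exists B : R, forall n, cabs (f n) <= B.
Proof.
move=> /pinfty_ex_gt0[M M0 /= fM]; exists (complex.Re M) => n.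
by rewrite -lecR -normE RRe_real ?gtr0_real//; exact: fM.
Qed.

End RealNorm.

Section UltraLimit.
Variables (R : realType) (w : set_system nat).
Hypothesis w_ultra : UltraFilter w.

(** Compactness of the segment gives a cluster point, and a cluster point of an ultrafilter is a
    limit. *)
Lemma ultra_cvg (u : nat -> R) (C : R) : (forall n, 0 <= u n <= C) ->
  exists2 l : R, 0 <= l & u @ w --> l.
Proof.
move=> uC; have [|l [l0C lw]] := @segment_compact R 0 C (u @ w) _.
  change (w (u @^-1` `[0, C])); suff -> : u @^-1` `[0, C] = setT by exact: filterT.
  by apply/seteqP; split=> // n _; rewrite /= in_itv; exact: uC.
exists l; first by move: l0C; rewrite /= in_itv => /andP[].
move=> V lV; have [//|wV] := in_ultra_setVsetC (u @^-1` V) w_ultra.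
have [_ [[n nV <-] Vn]] : (u @` (~` (u @^-1` V))) `&` V !=set0.
  apply: lw => //; change (w (u @^-1` (u @` (~` (u @^-1` V))))).
  by apply: filterS wV => n nV; exists n.
by exfalso; apply: nV.
Qed.

Lemma cvg_real_complex (u : nat -> R) (l : R) : u @ w --> l ->
  ((fun n => (u n)%:C : R[i]^o) @ w --> (l%:C : R[i]^o)).
Proof.
move=> ul; apply/cvgrPdist_lt => e e0.
have eE : e = (complex.Re e)%:C by rewrite RRe_real ?gtr0_real.
have e0' : 0 < complex.Re e by rewrite -ltcR -eE.
move/cvgrPdist_lt : ul => /(_ _ e0'); apply: filterS => n.
by rewrite -rmorphB/= normE cabsR eE ltcR.
Qed.

(** Turns the complex value of a mean state into a limit of real averages, from which [w]-large sets
    of [N] can be extracted. *)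
Lemma ultramean_real (a : nat -> R) (C : R) : (forall n, 0 <= a n <= C) ->
  exists l : R, [/\ 0 <= l, ultramean w (fun n => (a n)%:C : R[i]^o) = l%:C &
    (fun n => n%:R^-1 * \sum_(0 <= j < n) a j) @ w --> l].
Proof.
move=> aC; have [|l l0 ul] :=
    @ultra_cvg (fun n => n%:R^-1 * \sum_(0 <= j < n) a j) C.
  (* At [n = 0] the average is 0, as [0^-1 = 0]. *)
  move=> [|n].
    rewrite invr0 mul0r lexx /=; have /andP[? ?] := aC 0%N.
    exact: le_trans (_ : a 0%N <= _).
  apply/andP; split.
    by rewrite mulr_ge0// ?invr_ge0// sumr_ge0// => i _; case/andP: (aC i).
  rewrite mulrC ler_pdivrMr ?ltr0n//.
  apply: le_trans (_ : \sum_(0 <= j < n.+1) C <= _).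
    by apply: ler_sum => i _; case/andP: (aC i).
  by rewrite sumr_const_nat subn0 mulr_natr.
exists l; split=> //; rewrite /ultramean.
apply: cvg_lim; first exact: norm_hausdorff.
rewrite (_ : (fun n => _) = (fun n => (n%:R^-1 * \sum_(0 <= j < n) a j)%:C : R[i]^o)).
  exact: cvg_real_complex.
by apply/funext => n; rewrite rmorphM/= fmorphV rmorph_nat rmorph_sum.
Qed.

End UltraLimit.

(** * Asymptotic periodicity *)

Lemma iter_shift (V : Type) (f : nat -> V) k n :
  iter k (@Defs.shift V) f n = f (n + k)%N.
Proof. by elim: k n => [|k IH] n /=; rewrite ?addn0// /Defs.shift IH addSnnS. Qed.

(** Passes from the mean square along [w] to the mean absolute deviation on a [w]-large set of [N].
    A single shift whose mean norm is below [e] suffices. *)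
Lemma ap_period (R : realType) (f : nat -> R[i]^o) (B : R) (w : set_system nat)
    (w_ultra : UltraFilter w) :
  (forall n, cabs (f n) <= B) -> (forall N0, w [set N | (N0 <= N)%N]) ->
  asymptotically_periodic f -> forall e : R, 0 < e ->
  exists2 n, (0 < n)%N & w [set N |
    \sum_(0 <= m < N) cabs (f (m + n)%N - f m) <= e * N%:R].
Proof.
move=> fB w_tail f_ap e e0.
have w_free : free_filter w.
  apply/seteqP; split=> // x /(_ _ (w_tail x.+1)).
  by rewrite /= ltnn.
have [|k_ k_gt0 mean0] := f_ap (ultramean w); first by exists w.
have eC : (0 : R[i]) < e%:C by rewrite ltcR.
have [J _ /(_ J (leqnn J))] := cvgr0_norm_lt _ mean0 _ eC.
rewrite /mean_norm; set k := k_ J => hJ.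
exists k; first exact: k_gt0.
pose a m := cabs (f (m + k)%N - f m) ^+ 2.
have a_le m : 0 <= a m <= (B + B) ^+ 2.
  rewrite /a exprn_ge0 ?cabs_ge0//= lerXn2r ?nnegrE ?cabs_ge0//.
    by rewrite addr_ge0// (le_trans (cabs_ge0 (f 0%N)))// fB.
  apply: le_trans (cabsD _ _) _; apply: lerD; first exact: fB.
  by rewrite -[- _]sub0r cabsC subr0 fB.
have [l [l0 El al]] := ultramean_real w_ultra a_le.
have le2 : l < e ^+ 2.
  rewrite -ltcR -El; move: hJ.
  rewrite (_ : (fun n => _) = (fun n => (a n)%:C : R[i]^o)); last first.
    by apply/funext => n; rewrite iter_shift normE cabsC /a rmorphXn.
  rewrite El => hJ; rewrite -[ltLHS]sqrtCK.
  have s0 : 0 <= sqrtC (l%:C : R[i]) by rewrite sqrtC_ge0 ler0c.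
  rewrite rmorphXn/= ltrXn2r//.
  by rewrite -[X in X < _](ger0_norm s0).
apply: filterS (filterI (cvgr_lt _ al _ le2) (w_tail 1%N)) => N [/= hN N1].
have N0 : (0 : R) < N%:R by rewrite ltr0n.
have {}hN : \sum_(0 <= m < N) a m <= e ^+ 2 * N%:R.
  by move: hN; rewrite mulrC ltr_pdivrMr// => /ltW.
(* AM-GM: 2 e x <= e^2 + x^2 *)
have : 2 * e * \sum_(0 <= m < N) cabs (f (m + k)%N - f m) <=
       \sum_(0 <= m < N) (e ^+ 2 + a m).
  rewrite mulr_sumr; apply: ler_sum => m _; rewrite /a.
  set x := cabs _; have := sqr_ge0 (e - x); nra.
rewrite big_split/= sumr_const_nat subn0 -mulr_natr => h.
rewrite -(ler_pM2l (x := 2 * e)) ?mulr_gt0//; nra.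
Qed.

(** * Comparison of Möbius averages and the final contradiction *)

Lemma shifted_sum_le (R : realType) (h : nat -> R) N C : (forall n, 0 <= h n <= C) ->
  \sum_(1 <= n < N.+1) h n <= \sum_(0 <= n < N) h n + C.
Proof.
move=> hC; apply: (@le_trans _ _ (\sum_(0 <= n < N.+1) h n)).
  by rewrite [leRHS]big_ltn// lerDr; case/andP: (hC 0%N).
by rewrite big_nat_recr//= lerD2l; case/andP: (hC N).
Qed.

(** Holds because the Möbius function is bounded by 1; the extra [C] pays for moving the range from
    [1..N] to [0..N-1]. *)
Lemma mobius_average_dist (R : realType) (u v : nat -> R[i]^o) (C : R) N :
  (forall n, cabs (u n - v n) <= C) -> (0 < N)%N ->
  cabs (N%:R^-1 * \sum_(1 <= n < N.+1) (mobius n)%:~R * u n) <=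
  cabs (N%:R^-1 * \sum_(1 <= n < N.+1) (mobius n)%:~R * v n) +
  (\sum_(0 <= n < N) cabs (u n - v n) + C) / N%:R.
Proof.
move=> uvC N0; set U := \sum_(1 <= n < N.+1) _; set V := \sum_(1 <= n < N.+1) _.
have -> : N%:R^-1 * U = N%:R^-1 * V + N%:R^-1 * (U - V).
  by rewrite -mulrDr addrC subrK.
apply: le_trans (cabsD _ _) _; rewrite lerD2l cabsM cabs_natV mulrC.
rewrite ler_pM2r ?invr_gt0 ?ltr0n//.
apply: le_trans (shifted_sum_le _ _); last first.
  by move=> n; rewrite cabs_ge0 uvC.
rewrite /U /V -sumrB; apply: le_trans (cabs_sum _ _ _) _.
apply: ler_sum => n _; rewrite -mulrBr cabsM.
by rewrite ler_piMl ?cabs_ge0 ?cabs_mobius.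
Qed.

Theorem theorem1p10 (R : realType) (f : nat -> R[i]^o)
    (sarnak : sarnak_conjecture R)
    (f_bounded : bounded_fun f) (f_ap : asymptotically_periodic f) :
  mobius_disjoint f.
Proof.
apply/cvgr0Pnorm_lt => deltaC deltaC0.
pose delta := complex.Re deltaC.
have deltaE : deltaC = delta%:C by rewrite RRe_real ?gtr0_real.
have delta0 : 0 < delta by rewrite -ltcR -deltaE.
pose avg (u : nat -> R[i]^o) (N : nat) : R :=
  cabs (N%:R^-1 * \sum_(1 <= n < N.+1) (mobius n)%:~R * u n).
suff : \forall N \near \oo, avg f N < delta.
  by apply: filterS => N; rewrite normE deltaE ltcR.
apply: contrapT => bad.
pose S : set nat := [set N | ~ avg f N < delta].
(* [S] is infinite, since otherwise the averages would eventually be below [delta]. An ultrafilter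
   refining this filter contains [S] and every tail. *)
have S_proper : ProperFilter (within S \oo).
  apply: Build_ProperFilter => h.
  have {}h : \forall N \near \oo, S N -> False by exact: h.
  by apply: bad; apply: filterS h => N /= SN; apply: contrapT.
have [w [w_ultra Sw]] := ultraFilterLemma S_proper.
have w_tail N0 : w [set N | (N0 <= N)%N].
  by apply: Sw; apply: filterS (nbhs_infty_ge N0) => N.
have wS : w S by apply: Sw; apply: nearW => N.
have w_neq0 A : w A -> A !=set0 by exact: filter_ex.
have [B fB] := bounded_cabs f_bounded.
pose d x y := cabs (f x - f y).
have d0 x y : 0 <= d x y by exact: cabs_ge0.
have d_refl x : d x x = 0 by rewrite /d subrr cabs0.
have d_tri x y z : d x z <= d x y + d y z.
  by rewrite /d -[f x - f z](subrKA (f y)) cabsD.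
have d_le x y : d x y <= B + B.
  apply: le_trans (cabsD _ _) _; apply: lerD; first exact: fB.
  by rewrite -[- _]sub0r cabsC subr0 fB.
(* The final count spends [eta] on the average of [v], [2 * eta] on the distance from [f] to [v] and
   [eta] on the constant [C], in all half of [delta]. *)
have eta0 : 0 < delta / 8 by rewrite divr_gt0.
set eta := delta / 8 in eta0.
have [n [n_gt0 n_dvd n_approx]] := exists_scales w_tail d0 d_refl d_tri d_le
  (ap_period w_ultra fB w_tail f_ap) wS w_neq0 eta0.
have [Q [dec net]] := finite_net B eta0.
have /choice[q qP] : forall m, exists i, (i <= Q)%N /\ cabs (f m - dec i) <= eta.
  by move=> m; have [i ? ?] := net _ (fB m); exists i.
(* Rounding after erasing: [g] takes finitely many values and inherits the block periodicity of
   [erase_all]. *)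
pose g m := q (erase_all n m).
have g_le m : (g m <= Q)%N by case: (qP (erase_all n m)).
have g_block K0 : exists p K, [/\ (K0 <= K)%N, (0 < p)%N &
    forall b r, (r < K * p)%N ->
      g (b * (K * p) + r)%N = g (b * (K * p) + r %% p)%N].
  exists (n K0), K0.+2; split=> // [|b r rK]; first by rewrite -addn2 leq_addr.
  by rewrite /g erase_all_block.
have disj := sarnak_block_periodic g_le g_block dec sarnak.
pose v m : R[i]^o := dec (g m).
have eta0C : (0 : R[i]) < eta%:C by rewrite ltcR.
have [N1 _ hN1] := cvgr0_norm_lt _ disj _ eta0C.
pose C := B + B + eta.
have fv m : cabs (f m - v m) <= d m (erase_all n m) + eta.
  rewrite -[f m - v m](subrKA (f (erase_all n m))).
  by apply: le_trans (cabsD _ _) _; rewrite lerD2l; case: (qP (erase_all n m)).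
(* [N] is taken past [N1], where the average of [v] is small, and past [C / eta], so that
   [C <= eta * N]. *)
have [N [NN SN approx]] := n_approx (maxn N1 (Num.truncn (C / eta)).+1).
move: NN; rewrite geq_max => /andP[N1N CN].
have N_gt0 : (0 < N)%N by exact: leq_trans CN.
apply: SN.
apply: le_lt_trans (@mobius_average_dist R f v C N _ N_gt0) _.
  by move=> m; apply: le_trans (fv m) _; rewrite lerD2r.
have h1 : avg v N < eta by rewrite -ltcR -normE; exact: hN1.
have h2 : \sum_(0 <= m < N) cabs (f m - v m) <= eta * N%:R + eta * N%:R.
  apply: le_trans (ler_sum _ (fun m _ => fv m)) _.
  by rewrite big_split/= lerD// sumr_const_nat subn0 mulr_natr.
have h3 : C <= eta * N%:R.
  have : C / eta < N%:R.
    by apply: lt_le_trans (truncnS_gt _) _; rewrite ler_nat.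
  by rewrite ltr_pdivrMr// mulrC => /ltW.
have h4 : (\sum_(0 <= m < N) cabs (f m - v m) + C) / N%:R <= 3 * eta.
  by rewrite ler_pdivrMr ?ltr0n//; lra.
rewrite -/(avg v N); have : delta = 8 * eta by rewrite /eta; field.
lra.
Qed.
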